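(* Assume that $\delta:H\to\mathbb R^p$ is concave and that $u^1,\dots,u^N\in\mathcal U$ satisfy $\Psi(x^j)u^j+\delta(x^j)\ge 0$ for $j=1,\dots,N$. If $\Psi(x)\equiv\bar\Psi$ is constant on $H$, then for any $x=\sum_{j=1}^N\lambda_jx^j$ with $\lambda\in\Delta_N$, the input $u_\lambda=\sum_{j=1}^N\lambda_ju^j$ satisfies $\Psi(x)u_\lambda+\delta(x)\ge 0$.
   Context: Setting. Consider the control-affine system $\dot x=f(x)+g(x)u$ with $x\in\mathcal X\subseteq\mathbb R^n$, $u\in\mathcal U\subseteq\mathbb R^m$, where $f:\mathbb R^n\to\mathbb R^n$ and $g:\mathbb R^n\to\mathbb R^{n\times m}$ are locally Lipschitz and $\mathcal U$ is nonempty, compact and convex. Let $h_1,\dots,h_p:\mathcal X\to\mathbb R$ be $C^1$ and let $\alpha_1,\dots,\alpha_p$ be extended class-$\mathcal K_\infty$ functions (continuous, strictly increasing bijections $\mathbb R\to\mathbb R$ with $\alpha_i(0)=0$). With $\nabla h_i(x)$ the gradient as a row vector, put $L_fh_i(x)=\nabla h_i(x)f(x)\in\mathbb R$ and $L_gh_i(x)=\nabla h_i(x)g(x)\in\mathbb R^{1\times m}$. Let $\Psi(x)\in\mathbb R^{p\times m}$ be the matrix whose $i$th row is $L_gh_i(x)$, and let $\delta(x)\in\mathbb R^p$ have entries $\delta_i(x)=L_fh_i(x)+\alpha_i(h_i(x))$. The stacked control barrier function inequalities at $x$ are $\Psi(x)u+\delta(x)\ge 0$. Points $x^1,\dots,x^N\in\mathcal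 X$ (''vertices'') are given with convex hull $H=\mathrm{co}\{x^1,\dots,x^N\}\subseteq\mathcal X$. The simplex is $\Delta_N=\{\lambda\in\mathbb R^N:\lambda_j\ge 0,\ \sum_j\lambda_j=1\}$. Vector inequalities are componentwise, and concavity of vector-valued maps is componentwise. *)

(* Defs.v *)
From HB Require Import structures.
From mathcomp Require Import all_boot all_order all_algebra.
From mathcomp Require Import all_classical all_reals all_analysis.

Set Implicit Arguments.
Unset Strict Implicit.
Unset Printing Implicit Defensive.

Import Order.TTheory GRing.Theory Num.Theory.
Import numFieldNormedType.Exports.

Local Open Scope classical_set_scope.
Local Open Scope ring_scope.
Local Open Scope convex_scope.

(* Points of R^n and inputs in R^m are column vectors, so that [g x *m u] and
   [Psi g h x *m u] are the usual products; gradients are row vectors. *)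

Definition gradient (R : realType) (n : nat) (h : 'cV[R]_n -> R)
    (x : 'cV[R]_n) : 'rV[R]_n :=
  \row_(j < n) 'D_(delta_mx j 0) h x.

(* Here [h] is total on R^n, and being C^1 on a set [A] that need not be open
   means being C^1 on some open set containing [A]. *)
Definition C1_on (R : realType) (n : nat) (A : set 'cV[R]_n)
    (h : 'cV[R]_n -> R) : Prop :=
  exists V : set 'cV[R]_n,
    [/\ open V, A `<=` V, (forall x, V x -> differentiable h x)
      & (forall x, V x -> {for x, continuous (gradient h)})].

Definition locally_lipschitz (R : realType) (V W : normedModType R)
    (F : V -> W) : Prop :=
  forall x : V, exists2 B : set V, nbhs x B & [lipschitz F y | y in B].

Definition extended_class_Koo (R : realType) (a : R -> R) : Prop :=
  [/\ continuous a, {homo a : s t / s < t}, bijective a & a 0 = 0].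

Definition lie_f (R : realType) (n : nat) (f : 'cV[R]_n -> 'cV[R]_n)
    (h : 'cV[R]_n -> R) (x : 'cV[R]_n) : R :=
  (gradient h x *m f x) 0 0.

Definition lie_g (R : realType) (n m : nat) (g : 'cV[R]_n -> 'M[R]_(n, m))
    (h : 'cV[R]_n -> R) (x : 'cV[R]_n) : 'rV[R]_m :=
  gradient h x *m g x.

Definition Psi (R : realType) (n m p : nat) (g : 'cV[R]_n -> 'M[R]_(n, m))
    (h : 'I_p -> 'cV[R]_n -> R) (x : 'cV[R]_n) : 'M[R]_(p, m) :=
  \matrix_(i < p) lie_g g (h i) x.

Definition delta (R : realType) (n p : nat) (f : 'cV[R]_n -> 'cV[R]_n)
    (h : 'I_p -> 'cV[R]_n -> R) (alpha : 'I_p -> R -> R)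
    (x : 'cV[R]_n) : 'cV[R]_p :=
  \col_(i < p) (lie_f f (h i) x + alpha i (h i x)).

Definition nonneg_vec (R : realType) (p : nat) (v : 'cV[R]_p) : Prop :=
  forall i : 'I_p, 0 <= v i 0.

Definition convex_hull (R : realType) (n : nat) (A : set 'cV[R]_n) :
    set 'cV[R]_n :=
  smallest (@convex_set R 'cV[R]_n) A.

Definition simplex (R : realType) (N : nat) : set 'cV[R]_N :=
  [set l | nonneg_vec l /\ \sum_(j < N) l j 0 = 1].

(* Componentwise concavity on [A]; the pointwise inequality is the reverse of
   the one in [convex_function]. *)
Definition concave_map (R : realType) (n p : nat) (A : set 'cV[R]_n)
    (F : 'cV[R]_n -> 'cV[R]_p) : Prop :=
  forall (i : 'I_p) (t : {i01 R}) (x y : 'cV[R]_n), A x -> A y ->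
    (F x i 0 : R^o) <| t |> (F y i 0 : R^o) <=
    F ((x : convex_lmodType 'cV[R]_n) <| t |> y) i 0.

(* Main.v *)
Require Import Defs.
From HB Require Import structures.
From mathcomp Require Import all_boot all_order all_algebra.
From mathcomp Require Import all_classical all_reals all_analysis.
Import Order.TTheory GRing.Theory Num.Theory.
Import numFieldNormedType.Exports.
Local Open Scope classical_set_scope.
Local Open Scope ring_scope.
Local Open Scope convex_scope.

Set Implicit Arguments.
Unset Strict Implicit.
Unset Printing Implicit Defensive.

(** With [Psi] equal to [Psibar] on the hull, the term [Psibar *m u] is linear in the input, so at
    [u_lambda] it is the [lambda]-average of its values at the vertex inputs. Concavity bounds
    [delta] at [x] below by the same average of its vertex values ([concave_map_sum]). The left-hand
    side thus dominates a nonnegative combination of the vertex inequalities. Jensen's inequality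
    reduces to closure of convex sets under finite convex combinations ([convex_set_sum]). *)

(* The weights are not normalized so that the induction also goes through
   sublists of total weight [0]; hence the default point [y0]. *)
Lemma convex_set_weighted_sum (R : numFieldType) (M : lmodType R)
    (A : set (convex_lmodType M)) (I : Type) (s : seq I) (w : I -> R)
    (v : I -> M) (y0 : M) :
  convex_set A -> A y0 -> (forall i, 0 <= w i) -> (forall i, A (v i)) ->
  exists2 y : M, A y & \sum_(i <- s) w i *: v i = (\sum_(i <- s) w i) *: y.
Proof.
move=> cA Ay0 w_ge0 Av; elim: s => [|a s [y Ay IHs]].
  by exists y0; rewrite // !big_nil scale0r.
rewrite !big_cons IHs; set W := \sum_(i <- s) w i.
have W_ge0 : 0 <= W by exact: sumr_ge0.
(* If the total weight vanishes, both nonnegative parts do, and any point of [A] serves; otherwise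
   [y] is averaged with the head in proportion to the weights. *)
have [wW0|wW_neq0] := eqVneq (w a + W) 0.
  have /andP[/eqP -> /eqP ->] : (w a == 0) && (W == 0).
    by rewrite -paddr_eq0 // wW0.
  by exists y0; rewrite // !(addr0, scale0r).
have wW_gt0 : 0 < w a + W by rewrite lt_neqAle eq_sym wW_neq0 addr_ge0.
have t_ge0 : 0 <= w a / (w a + W) by rewrite divr_ge0 // ltW.
have t_le1 : w a / (w a + W) <= 1 by rewrite ler_pdivrMr // mul1r lerDl.
pose t : {i01 R} := Itv01 t_ge0 t_le1.
exists ((v a : convex_lmodType M) <| t |> y).
  by apply/set_mem/cA; apply/mem_set.
have -> : (v a : convex_lmodType M) <| t |> y =
  w a / (w a + W) *: v a + (1 - w a / (w a + W)) *: y by [].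
rewrite scalerDr !scalerA; congr (_ *: _ + _ *: _).
  by rewrite mulrC divfK.
by rewrite mulrBr mulr1 mulrC divfK // addrC addKr.
Qed.

Lemma convex_set_sum (R : numFieldType) (M : lmodType R)
    (A : set (convex_lmodType M)) (I : finType) (w : I -> R) (v : I -> M) :
  convex_set A -> (forall i, 0 <= w i) -> \sum_i w i = 1 ->
  (forall i, A (v i)) -> A (\sum_i w i *: v i).
Proof.
move=> cA w_ge0 w1 Av.
(* Weights summing to 1 force an index to exist; its vector is the default point. *)
have [i0 _|I0] := pickP I; last first.
  by move: w1 => /eqP; rewrite big_pred0 // eq_sym oner_eq0.
have [y Ay ->] :=
  convex_set_weighted_sum (index_enum I) cA (Av i0) w_ge0 Av.
by rewrite w1 scale1r.
Qed.

Lemma convex_convex_hull (R : realType) (n : nat) (A : set 'cV[R]_n) :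
  convex_set (convex_hull A).
Proof.
move=> x y t /set_mem Hx /set_mem Hy; apply/mem_set => B [cB AB].
by apply/set_mem/cB; apply/mem_set; [exact: Hx | exact: Hy].
Qed.

(* Jensen's inequality: the hypograph of each component of [F] is convex. *)
Lemma concave_map_sum (R : realType) (n p N : nat) (A : set 'cV[R]_n)
    (F : 'cV[R]_n -> 'cV[R]_p) (w : 'I_N -> R) (v : 'I_N -> 'cV[R]_n) i :
  convex_set A -> concave_map A F ->
  (forall j, 0 <= w j) -> \sum_j w j = 1 -> (forall j, A (v j)) ->
  \sum_j w j * F (v j) i 0 <= F (\sum_j w j *: v j) i 0.
Proof.
move=> cA cF w_ge0 w1 Av.
pose hyp : set ('cV[R]_n * R^o)%type := [set z | A z.1 /\ z.2 <= F z.1 i 0].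
have chyp : convex_set hyp.
  move=> [x a] [y b] t /set_mem[/= Ax aF] /set_mem[/= Ay bF].
  apply/mem_set; split => /=.
    by apply/set_mem/(cA x y t); apply/mem_set.
  apply: le_trans (cF i t x y Ax Ay).
  by apply: lerD; apply: ler_wpM2l; rewrite // subr_ge0.
(* The points averaged here lie on the graph of the component; the second coordinate of the average
   gives the inequality. *)
have := convex_set_sum (v := fun j => (v j, F (v j) i 0 : R^o))
  chyp w_ge0 w1 (fun j => conj (Av j) (lexx _)).
by case=> _; rewrite (raddf_sum snd) (raddf_sum fst).
Qed.

Theorem corollary2 (R : realType) (n m p N : nat)
    (X : set 'cV[R]_n) (U : set 'cV[R]_m)
    (f : 'cV[R]_n -> 'cV[R]_n) (g : 'cV[R]_n -> 'M[R]_(n, m))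
    (h : 'I_p -> 'cV[R]_n -> R) (alpha : 'I_p -> R -> R)
    (xv : 'I_N -> 'cV[R]_n) (uv : 'I_N -> 'cV[R]_m) (Psibar : 'M[R]_(p, m))
    (f_lip : locally_lipschitz f) (g_lip : locally_lipschitz g)
    (U_nonempty : U !=set0) (U_compact : compact U) (U_convex : convex_set U)
    (h_C1 : forall i, C1_on X (h i))
    (alpha_Koo : forall i, extended_class_Koo (alpha i))
    (hull_X : convex_hull (range xv) `<=` X)
    (delta_concave : concave_map (convex_hull (range xv)) (delta f h alpha))
    (uv_U : forall j, U (uv j))
    (vertex_ineq : forall j,
       nonneg_vec (Psi g h (xv j) *m uv j + delta f h alpha (xv j)))
    (Psi_const : forall x, convex_hull (range xv) x -> Psi g h x = Psibar) :
  forall (lambda : 'cV[R]_N) (x : 'cV[R]_n),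
    simplex lambda -> x = \sum_(j < N) lambda j 0 *: xv j ->
    let u_lambda := \sum_(j < N) lambda j 0 *: uv j in
    nonneg_vec (Psi g h x *m u_lambda + delta f h alpha x).
Proof.
move=> w x [w_ge0 w1] x_def u_lambda i.
pose H := convex_hull (range xv).
have Hxv j : H (xv j) by apply: sub_gen_smallest; exists j.
have cH : convex_set H := @convex_convex_hull R n (range xv).
have Hx : H x by rewrite x_def; exact: convex_set_sum.
have delta_ge := concave_map_sum i cH delta_concave w_ge0 w1 Hxv.
(* Once [delta] at [x] is replaced by its lower bound, both terms are sums over the vertices with
   the same weights and merge. *)
rewrite Psi_const // mxE x_def; apply: le_trans (lerD (lexx _) delta_ge).
rewrite mulmx_sumr summxE -big_split; apply: sumr_ge0 => j _ /=.
rewrite -scalemxAr mxE -mulrDr mulr_ge0 //.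
by have := vertex_ineq j i; rewrite (Psi_const _ (Hxv j)) mxE.
Qed.
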